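(* Assume $\varepsilon_k>0$ for all $k\in[K]$. Let $\mathbf w^\circ\in\Delta_K$ be the weight vector $$w_k^\circ:=\frac{\xi_k^{-1}}{\sum_{j=1}^K\xi_j^{-1}},\qquad \xi_k:=\varepsilon_k^2(1+\varepsilon_k^2),\qquad k\in[K].$$ If $\theta(\mathbf w^\circ)>0$, then $$J(\mathbf w^\circ)\le\theta(\mathbf w^\circ)^{-2}J^\ast,\qquad J^\ast:=\inf_{\mathbf w\in\Delta_K}J(\mathbf w).$$ In particular, if $\theta(\mathbf w^\circ)\ge c_0$ for some absolute constant $c_0\in(0,1)$, then $J(\mathbf w^\circ)\le c_0^{-2}J^\ast$, so $\mathbf w^\circ$ attains the same order as the unrestricted infimum $J^\ast$.
   Context: $\|\cdot\|$ is the operator norm; $\mathbb O_{p,q}$ is the set of $p\times q$ matrices with orthonormal columns; $\Delta_K=\{\mathbf w\in\mathbb R^K:w_k\ge0,\sum_kw_k=1\}$. Fixed data: $\mathbf U\in\mathbb O_{n,r}$, $\mathbf U_k\in\mathbb O_{n,r_k}$ with $\mathbf U^\top\mathbf U_k=0$ ($k\in[K]$), $\bar r_k=r+r_k<n$, $\bar{\mathbf U}_k=[\mathbf U\ \mathbf U_k]$, and $\bar{\mathbf U}_{k\perp}\in\mathbb O_{n,n-\bar r_k}$ an orthonormal basis of the orthogonal complement of its column space. The numbers $\varepsilon_k$ are $\varepsilon_k=n^{1/2}\mathrm{SNR}_k^{-1}+(nd_k)^{1/2}\mathrm{SNR}_k^{-2}$, where $\mathrm{SNR}_k=\lambda_{k,\min}/\sigma_k$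 is the signal-to-noise ratio and $d_k$ the number of columns of the $k$-th data matrix; only positivity of the $\varepsilon_k$ matters here. For $\mathbf w\in\Delta_K$ let $\theta(\mathbf w):=1-\|\sum_kw_k\mathbf U_k\mathbf U_k^\top\|$ and $\mathcal D:=\{\mathbf w\in\Delta_K:\theta(\mathbf w)>0\}$. For $\mathbf w\in\mathcal D$ write the rank-$(n-r)$ eigendecomposition $\mathbf I-\sum_kw_k\bar{\mathbf U}_k\bar{\mathbf U}_k^\top=\mathbf U_\perp\boldsymbol\Lambda\mathbf U_\perp^\top$ ($\mathbf U_\perp\in\mathbb O_{n,n-r}$, $\boldsymbol\Lambda$ invertible; both depend on $\mathbf w$), $\mathbf M_k(\mathbf w):=\bar{\mathbf U}_{k\perp}^\top\mathbf U_\perp\boldsymbol\Lambda^{-2}\mathbf U_\perp^\top\bar{\mathbf U}_{k\perp}$, $q_k(\mathbf w):=n^{-1}\{\operatorname{tr}(\mathbf M_k(\mathbf w))+\bar r_k\|\mathbf M_k(\mathbf w)\|\}$, and $$J(\mathbf w):=\sum_{k=1}^Kw_k^2\big\{q_k(\mathbf w)\varepsilon_k^2+\theta(\mathbf w)^{-2}\varepsilon_k^4\big\};$$ set $J(\mathbf w):=+\infty$ for $\mathbf w\in\Delta_K\setminus\mathcal D$. *)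

(* Defs.v *)
From HB Require Import structures.
From mathcomp Require Import all_boot all_order all_algebra.
From mathcomp Require Import all_classical all_reals ereal.

Set Implicit Arguments.
Unset Strict Implicit.
Unset Printing Implicit Defensive.

Import Order.TTheory GRing.Theory Num.Theory.
Local Open Scope classical_set_scope.
Local Open Scope ring_scope.

Definition l2norm (R : realType) (n : nat) (x : 'cV[R]_n) : R :=
  Num.sqrt (\sum_i x i 0 ^+ 2).

(* Spectral norm: the library norm on matrices is the entrywise sup norm. *)
Definition opnorm (R : realType) (p q : nat) (A : 'M[R]_(p, q)) : R :=
  sup [set l2norm (A *m x) | x in [set x : 'cV[R]_q | l2norm x <= 1]].

Definition orthonormal_cols (R : realType) (p q : nat) (A : 'M[R]_(p, q)) :=
  A^T *m A = 1%:M.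

(* The rows of [kermx W] span {x^T : x^T W = 0}, so the second clause says that
   the column space of V is the orthogonal complement of that of W. *)
Definition orthonormal_compl_basis (R : realType) (n p q : nat)
    (W : 'M[R]_(n, p)) (V : 'M[R]_(n, q)) :=
  orthonormal_cols V /\ (V^T == kermx W)%MS.

Definition eigendecomposition (R : realType) (n m : nat)
    (A : 'M[R]_n) (P : 'M[R]_(n, m)) (L : 'M[R]_m) :=
  [/\ orthonormal_cols P, is_diag_mx L, L \in unitmx & A = P *m L *m P^T].

Definition simplex (R : realType) (K : nat) : set 'rV[R]_K :=
  [set w | (forall k, 0 <= w 0 k) /\ \sum_k w 0 k = 1].

Definition theta (R : realType) (n K : nat) (rk : 'I_K -> nat)
    (Uk : forall k, 'M[R]_(n, rk k)) (w : 'rV[R]_K) : R :=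
  1 - opnorm (\sum_k w 0 k *: (Uk k *m (Uk k)^T)).

Definition weight_domain (R : realType) (n K : nat) (rk : 'I_K -> nat)
    (Uk : forall k, 'M[R]_(n, rk k)) : set 'rV[R]_K :=
  [set w | simplex w /\ 0 < theta Uk w].

Definition Ubar (R : realType) (n r K : nat) (rk : 'I_K -> nat)
    (U : 'M[R]_(n, r)) (Uk : forall k, 'M[R]_(n, rk k)) (k : 'I_K) :
    'M[R]_(n, r + rk k) :=
  row_mx U (Uk k).

Definition residual (R : realType) (n r K : nat) (rk : 'I_K -> nat)
    (U : 'M[R]_(n, r)) (Uk : forall k, 'M[R]_(n, rk k)) (w : 'rV[R]_K) :
    'M[R]_n :=
  1%:M - \sum_k w 0 k *: (Ubar U Uk k *m (Ubar U Uk k)^T).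

Definition Mmx (R : realType) (n m q : nat)
    (V : 'M[R]_(n, q)) (P : 'M[R]_(n, m)) (L : 'M[R]_m) : 'M[R]_q :=
  V^T *m P *m (invmx L *m invmx L) *m P^T *m V.

(* [Ubarperp k], [Uperp w] and [Lam w] are the chosen orthonormal bases and
   eigendecompositions; [Uperp] and [Lam] are only used on [weight_domain Uk]. *)
Definition qcoef (R : realType) (n r K : nat) (rk : 'I_K -> nat)
    (Ubarperp : forall k, 'M[R]_(n, n - (r + rk k)))
    (Uperp : 'rV[R]_K -> 'M[R]_(n, n - r)) (Lam : 'rV[R]_K -> 'M[R]_(n - r))
    (k : 'I_K) (w : 'rV[R]_K) : R :=
  let M := Mmx (Ubarperp k) (Uperp w) (Lam w) in
  n%:R^-1 * (\tr M + (r + rk k)%:R * opnorm M).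

Definition J (R : realType) (n r K : nat) (rk : 'I_K -> nat)
    (Uk : forall k, 'M[R]_(n, rk k))
    (Ubarperp : forall k, 'M[R]_(n, n - (r + rk k)))
    (Uperp : 'rV[R]_K -> 'M[R]_(n, n - r)) (Lam : 'rV[R]_K -> 'M[R]_(n - r))
    (eps : 'I_K -> R) (w : 'rV[R]_K) : \bar R :=
  if w \in weight_domain Uk then
    (\sum_k w 0 k ^+ 2 * (qcoef Ubarperp Uperp Lam k w * eps k ^+ 2
                          + theta Uk w ^- 2 * eps k ^+ 4))%:E
  else +oo%E.

Definition Jstar (R : realType) (n r K : nat) (rk : 'I_K -> nat)
    (Uk : forall k, 'M[R]_(n, rk k))
    (Ubarperp : forall k, 'M[R]_(n, n - (r + rk k)))
    (Uperp : 'rV[R]_K -> 'M[R]_(n, n - r)) (Lam : 'rV[R]_K -> 'M[R]_(n - r))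
    (eps : 'I_K -> R) : \bar R :=
  ereal_inf [set J Uk Ubarperp Uperp Lam eps w | w in @simplex R K].

Definition xi (R : realType) (K : nat) (eps : 'I_K -> R) (k : 'I_K) : R :=
  eps k ^+ 2 * (1 + eps k ^+ 2).

Definition wcirc (R : realType) (K : nat) (eps : 'I_K -> R) : 'rV[R]_K :=
  \row_k ((xi eps k)^-1 / \sum_j (xi eps j)^-1).

(* Main.v *)
(* Write S = sum_k w_k U_k U_k^T.  On the orthogonal complement of the range of
   U the residual matrix acts as I - S, and theta |z| <= |z - S z| <= |z|.
   Since the columns of [Ubarperp k] lie in that complement, M_k(w) = G^T G
   with |x| <= |G x| <= theta^-1 |x|, whence 1 <= q_k(w) <= theta^-2.  So
   J(w) >= sum_k w_k^2 xi_k >= (sum_k xi_k^-1)^-1 by Cauchy-Schwarz, with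
   equality on the right at [wcirc], where J <= theta^-2 sum_k w_k^2 xi_k. *)
Require Import Defs.
From HB Require Import structures.
From mathcomp Require Import all_boot all_order all_algebra.
From mathcomp Require Import all_classical all_reals ereal.
From mathcomp Require Import ring lra.

Set Implicit Arguments.
Unset Strict Implicit.
Unset Printing Implicit Defensive.

Import Order.TTheory GRing.Theory Num.Theory.
Local Open Scope classical_set_scope.
Local Open Scope ring_scope.

(** * The Euclidean norm *)

Definition dot (R : realType) (n : nat) (u v : 'cV[R]_n) : R := (u^T *m v) 0 0.

Lemma dotDl (R : realType) (n : nat) (u v z : 'cV[R]_n) :
  dot (u + v) z = dot u z + dot v z.
Proof. by rewrite /dot linearD mulmxDl mxE. Qed.

Lemma dotZl (R : realType) (n : nat) (a : R) (u v : 'cV[R]_n) :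
  dot (a *: u) v = a * dot u v.
Proof. by rewrite /dot linearZ -scalemxAl mxE. Qed.

Lemma dotC (R : realType) (n : nat) (u v : 'cV[R]_n) : dot u v = dot v u.
Proof. by rewrite /dot -[in LHS](trmxK v) -trmx_mul mxE. Qed.

Lemma dotDr (R : realType) (n : nat) (u v z : 'cV[R]_n) :
  dot u (v + z) = dot u v + dot u z.
Proof. by rewrite dotC dotDl !(dotC _ u). Qed.

Lemma dotZr (R : realType) (n : nat) (a : R) (u v : 'cV[R]_n) :
  dot u (a *: v) = a * dot u v.
Proof. by rewrite dotC dotZl dotC. Qed.

Lemma dot_mulmx (R : realType) (p q : nat) (A : 'M[R]_(p, q)) u v :
  dot u (A *m v) = dot (A^T *m u) v.
Proof. by rewrite /dot trmx_mul trmxK mulmxA. Qed.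

Lemma l2norm_ge0 (R : realType) (n : nat) (x : 'cV[R]_n) : 0 <= l2norm x.
Proof. exact: sqrtr_ge0. Qed.

Lemma l2norm_sqr (R : realType) (n : nat) (x : 'cV[R]_n) :
  l2norm x ^+ 2 = dot x x.
Proof.
rewrite sqr_sqrtr ?sumr_ge0// => [|i _]; last exact: sqr_ge0.
by rewrite /dot mxE; apply: eq_bigr => i _; rewrite mxE expr2.
Qed.

Lemma l2norm_le_sqr (R : realType) (m n : nat) (x : 'cV[R]_m) (y : 'cV[R]_n) :
  (l2norm x <= l2norm y) = (dot x x <= dot y y).
Proof. by rewrite -!l2norm_sqr ler_sqr// nnegrE l2norm_ge0. Qed.

Lemma l2norm_eq (R : realType) (m n : nat) (x : 'cV[R]_m) (y : 'cV[R]_n) :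
  dot x x = dot y y -> l2norm x = l2norm y.
Proof. by move=> e; apply/eqP; rewrite eq_le !l2norm_le_sqr e lexx. Qed.

Lemma l2norm0 (R : realType) (n : nat) : l2norm (0 : 'cV[R]_n) = 0.
Proof. by apply/eqP; rewrite -sqrf_eq0 l2norm_sqr /dot mulmx0 mxE. Qed.

Lemma l2normZ (R : realType) (n : nat) (a : R) (x : 'cV[R]_n) :
  0 <= a -> l2norm (a *: x) = a * l2norm x.
Proof.
move=> a0; apply/eqP; rewrite -(@eqrXn2 _ 2)// ?mulr_ge0 ?l2norm_ge0//.
by rewrite exprMn !l2norm_sqr dotZl dotZr mulrA expr2.
Qed.

Lemma l2norm_delta (R : realType) (n : nat) (i : 'I_n) :
  l2norm (delta_mx i 0 : 'cV[R]_n) = 1.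
Proof.
apply/eqP; rewrite -(@eqrXn2 _ 2)// ?l2norm_ge0// l2norm_sqr /dot trmx_delta.
by rewrite mul_delta_mx mxE !eqxx expr1n.
Qed.

Lemma l2norm_eq0 (R : realType) (n : nat) (x : 'cV[R]_n) :
  l2norm x = 0 -> x = 0.
Proof.
move=> x0; have : \sum_i x i 0 ^+ 2 = 0.
  apply/eqP; rewrite eq_le sumr_ge0 => [|i _]; last exact: sqr_ge0.
  by rewrite -sqrtr_eq0 andbT; apply/eqP.
move/psumr_eq0P => h; apply/matrixP => i j; rewrite ord1 mxE; apply/eqP.
by rewrite -sqrf_eq0 h// => k _; exact: sqr_ge0.
Qed.

(** Cauchy-Schwarz: the squared norm of [l2norm v *: u - l2norm u *: v] is nonnegative, and it
    expands to twice [l2norm u * l2norm v] times the gap. Zero vectors are split off so that this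
    factor can be cancelled. *)
Lemma dot_le (R : realType) (n : nat) (u v : 'cV[R]_n) :
  dot u v <= l2norm u * l2norm v.
Proof.
have [/l2norm_eq0 ->|u0] := eqVneq (l2norm u) 0.
  by rewrite /dot trmx0 mul0mx mxE mulr_ge0 ?l2norm_ge0.
have [/l2norm_eq0 ->|v0] := eqVneq (l2norm v) 0.
  by rewrite /dot mulmx0 mxE mulr_ge0 ?l2norm_ge0.
have uv0 : 0 < l2norm u * l2norm v.
  by rewrite mulr_gt0// lt_neqAle eq_sym ?u0 ?v0 l2norm_ge0.
rewrite -(ler_pM2l uv0).
have := sqr_ge0 (l2norm (l2norm v *: u + (- l2norm u) *: v)).
rewrite l2norm_sqr !(dotDl, dotDr, dotZl, dotZr) -!l2norm_sqr (dotC v u).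
by nra.
Qed.

Lemma ler_l2normD (R : realType) (n : nat) (u v : 'cV[R]_n) :
  l2norm (u + v) <= l2norm u + l2norm v.
Proof.
rewrite -ler_sqr ?nnegrE ?addr_ge0 ?l2norm_ge0//.
rewrite l2norm_sqr !(dotDl, dotDr) -!l2norm_sqr (dotC v u).
by have := dot_le u v; nra.
Qed.

Lemma ler_l2normB (R : realType) (n : nat) (u v : 'cV[R]_n) :
  l2norm u - l2norm v <= l2norm (u - v).
Proof. by rewrite lerBlDr -{1}(subrK v u) ler_l2normD. Qed.

(** Convexity of balls. It serves both for averages of projections and for averages of complementary
    projections. *)
Lemma l2norm_convex_le (R : realType) (n K : nat) (w : 'rV[R]_K)
    (u : 'I_K -> 'cV[R]_n) (c : R) :
  simplex w -> (forall k, l2norm (u k) <= c) ->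
  l2norm (\sum_k w 0 k *: u k) <= c.
Proof.
move=> [w0 w1] uc; apply: (@le_trans _ _ (\sum_k w 0 k * c)); last first.
  by rewrite -mulr_suml w1 mul1r.
elim/big_ind2 : _ => [|x a y b xa yb|k _]; first by rewrite l2norm0.
- exact: le_trans (ler_l2normD _ _) (lerD xa yb).
- by rewrite l2normZ// ler_wpM2l.
Qed.

(** * The spectral norm *)

Lemma opnorm_ubound (R : realType) (p q : nat) (A : 'M[R]_(p, q)) (c : R) :
  (forall x, l2norm (A *m x) <= c * l2norm x) -> 0 <= c ->
  ubound [set l2norm (A *m x) | x in [set x : 'cV[R]_q | l2norm x <= 1]] c.
Proof.
by move=> Ac c0 _ [x /= x1 <-]; apply: (le_trans (Ac x)); rewrite ler_piMr.
Qed.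

Lemma opnorm_le (R : realType) (p q : nat) (A : 'M[R]_(p, q)) (c : R) :
  (forall x, l2norm (A *m x) <= c * l2norm x) -> 0 <= c -> opnorm A <= c.
Proof.
move=> Ac c0; apply: ge_sup; last exact: opnorm_ubound.
by exists (l2norm (A *m 0)), 0 => //=; rewrite l2norm0.
Qed.

(* The bound [c] only guarantees that the supremum defining [opnorm A] is not
   the junk value of an unbounded set. *)
Lemma l2norm_mulmx_le (R : realType) (p q : nat) (A : 'M[R]_(p, q)) (c : R) :
  (forall x, l2norm (A *m x) <= c * l2norm x) -> 0 <= c ->
  forall x, l2norm (A *m x) <= opnorm A * l2norm x.
Proof.
move=> Ac c0 x.
have [/l2norm_eq0 ->|x0] := eqVneq (l2norm x) 0.
  by rewrite mulmx0 !l2norm0 mulr0.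
have xp : 0 < l2norm x by rewrite lt_neqAle eq_sym x0 l2norm_ge0.
rewrite mulrC -ler_pdivrMl// -l2normZ ?invr_ge0 ?l2norm_ge0// scalemxAr.
apply: ub_le_sup; first by exists c; exact: opnorm_ubound.
exists ((l2norm x)^-1 *: x) => //=.
by rewrite l2normZ ?invr_ge0 ?l2norm_ge0// mulVf.
Qed.

(** * Gram matrices of maps bounded above and below *)

Section gram_bounds.
Variables (R : realType) (p q : nat) (G : 'M[R]_(p, q)) (c : R).
Hypotheses (c0 : 0 <= c) (Glb : forall x, l2norm x <= l2norm (G *m x))
  (Gub : forall x, l2norm (G *m x) <= c * l2norm x).

Let gram_ub x : l2norm (G^T *m G *m x) <= c ^+ 2 * l2norm x.
Proof.
(* The transpose inherits the bound [c]: the square of |G^T u| is <u, G G^T u>, at most c |u| |G^T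
   u|, and one factor |G^T u| cancels. *)
have tub u : l2norm (G^T *m u) <= c * l2norm u.
  have [->|t0] := eqVneq (l2norm (G^T *m u)) 0.
    by rewrite mulr_ge0 ?l2norm_ge0.
  have tp : 0 < l2norm (G^T *m u) by rewrite lt_neqAle eq_sym t0 l2norm_ge0.
  rewrite -(ler_pM2l tp) -expr2 l2norm_sqr -dot_mulmx.
  apply: (le_trans (dot_le _ _)).
  by have := Gub (G^T *m u); have := l2norm_ge0 u; nra.
rewrite -mulmxA; apply: (le_trans (tub _)).
by rewrite expr2 -mulrA ler_wpM2l.
Qed.

Lemma opnorm_gram_le : opnorm (G^T *m G) <= c ^+ 2.
Proof. by apply: opnorm_le (sqr_ge0 _) => x; exact: gram_ub. Qed.

(** Tested on one basis vector e, where <e, G^T G e> = |G e|^2. With [q = 0] there is no such vector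
    and the norm is 0. *)
Lemma opnorm_gram_ge1 : (0 < q)%N -> 1 <= opnorm (G^T *m G).
Proof.
move=> q0; pose e : 'cV[R]_q := delta_mx (Ordinal q0) 0.
have e1 : l2norm e = 1 by exact: l2norm_delta.
have := l2norm_mulmx_le gram_ub (sqr_ge0 _) e; rewrite e1 mulr1.
apply: le_trans.
have := dot_le e (G^T *m G *m e); rewrite e1 mul1r.
apply: le_trans; rewrite -mulmxA dot_mulmx trmxK -l2norm_sqr.
by have := Glb e; rewrite e1; nra.
Qed.

Let gram_diag i : (G^T *m G) i i = l2norm (G *m delta_mx i 0) ^+ 2.
Proof.
rewrite l2norm_sqr -colE /dot !mxE.
by apply: eq_bigr => k _; rewrite !mxE.
Qed.

(** Each diagonal entry is the squared norm of the image of a basis vector, hence lies between 1 and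
    [c ^+ 2]. *)
Lemma tr_gram_bounds : q%:R <= \tr (G^T *m G) <= c ^+ 2 * q%:R.
Proof.
rewrite -[q in q%:R]card_ord -sumr_const mulr_sumr; apply/andP; split.
  apply: ler_sum => i _; rewrite gram_diag.
  by have := Glb (delta_mx i 0); rewrite l2norm_delta; nra.
apply: ler_sum => i _; rewrite gram_diag mulr1.
have := Gub (delta_mx i 0); rewrite l2norm_delta mulr1.
by have := l2norm_ge0 (G *m delta_mx i 0); nra.
Qed.

End gram_bounds.

(** * Convex combinations of projections *)

(** Pythagoras: the cross term vanishes because [U *m U^T] is symmetric and idempotent. *)
Lemma l2norm_sqr_proj (R : realType) (n r : nat) (U : 'M[R]_(n, r))
    (x : 'cV[R]_n) : orthonormal_cols U ->
  l2norm x ^+ 2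
    = l2norm (U *m U^T *m x) ^+ 2 + l2norm (x - U *m U^T *m x) ^+ 2.
Proof.
move=> hU; rewrite !l2norm_sqr -scaleN1r !(dotDl, dotDr, dotZl, dotZr).
rewrite (dotC _ x).
have -> : dot (U *m U^T *m x) (U *m U^T *m x) = dot x (U *m U^T *m x).
  rewrite -{2}mulmxA dot_mulmx !mulmxA hU mul1mx -mulmxA.
  by rewrite [RHS]dot_mulmx.
by ring.
Qed.

Lemma l2norm_proj_le (R : realType) (n r : nat) (U : 'M[R]_(n, r))
    (x : 'cV[R]_n) : orthonormal_cols U ->
  l2norm (U *m U^T *m x) <= l2norm x.
Proof.
move=> hU; rewrite -ler_sqr ?nnegrE ?l2norm_ge0//.
by rewrite (l2norm_sqr_proj x hU) lerDl sqr_ge0.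
Qed.

Lemma l2norm_projC_le (R : realType) (n r : nat) (U : 'M[R]_(n, r))
    (x : 'cV[R]_n) : orthonormal_cols U ->
  l2norm (x - U *m U^T *m x) <= l2norm x.
Proof.
move=> hU; rewrite -ler_sqr ?nnegrE ?l2norm_ge0//.
by rewrite [leRHS](l2norm_sqr_proj x hU) lerDr sqr_ge0.
Qed.

Lemma orthonormal_completion (R : realType) (n r : nat) (U : 'M[R]_(n, r))
    (P : 'M[R]_(n, n - r)) : (r <= n)%N ->
  orthonormal_cols U -> orthonormal_cols P -> P^T *m U = 0 ->
  P *m P^T + U *m U^T = 1%:M.
Proof.
move=> rn hU hP PU.
have UP : U^T *m P = 0 by rewrite -[LHS]trmxK trmx_mul trmxK PU trmx0.
(* The block matrix [P U] has [n - r + r] columns, which equals [n] only propositionally. Once the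
   equality is eliminated, a left inverse of a square matrix is a right inverse. *)
have sq m (e : m = n) (B : 'M[R]_(n, m)) : B^T *m B = 1%:M -> B *m B^T = 1%:M.
  by case: _ / e in B *; exact: mulmx1C.
rewrite -mul_row_col -tr_row_mx; apply: sq; first exact: subnK.
by rewrite tr_row_mx mul_col_row hU hP PU UP -scalar_mx_block.
Qed.

Section weighted_projections.
Variables (R : realType) (n r K : nat) (rk : 'I_K -> nat).
Variables (U : 'M[R]_(n, r)) (Uk : forall k : 'I_K, 'M[R]_(n, rk k)).
Hypothesis hUk : forall k, orthonormal_cols (Uk k).
Variable w : 'rV[R]_K.
Hypothesis hw : simplex w.

Let S := \sum_k w 0 k *: (Uk k *m (Uk k)^T).

Let mulS (x : 'cV[R]_n) : S *m x = \sum_k w 0 k *: (Uk k *m (Uk k)^T *m x).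
Proof. by rewrite mulmx_suml; apply: eq_bigr => k _; rewrite -scalemxAl. Qed.

Let normS_le (x : 'cV[R]_n) : l2norm (S *m x) <= 1 * l2norm x.
Proof.
by rewrite mul1r mulS; apply: l2norm_convex_le => // k; exact: l2norm_proj_le.
Qed.

Lemma theta_lower (x : 'cV[R]_n) : theta Uk w * l2norm x <= l2norm (x - S *m x).
Proof.
rewrite mulrBl mul1r; apply: le_trans (ler_l2normB _ _).
by rewrite lerD2l lerN2 (l2norm_mulmx_le normS_le).
Qed.

(** As the weights sum to 1, I - S is itself a convex combination of the projections I - U_k
    U_k^T. *)
Lemma l2norm_subS_le (x : 'cV[R]_n) : l2norm (x - S *m x) <= l2norm x.
Proof.
have -> : x - S *m x = \sum_k w 0 k *: (x - Uk k *m (Uk k)^T *m x).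
  under eq_bigr => k _ do rewrite scalerBr.
  by rewrite sumrB -scaler_suml hw.2 scale1r mulS.
by apply: l2norm_convex_le => // k; exact: l2norm_projC_le.
Qed.

Let UbarE k : Ubar U Uk k *m (Ubar U Uk k)^T = U *m U^T + Uk k *m (Uk k)^T.
Proof. by rewrite tr_row_mx mul_row_col. Qed.

Let residualE : residual U Uk w = 1%:M - U *m U^T - S.
Proof.
rewrite /residual; under eq_bigr => k _ do rewrite UbarE scalerDr.
by rewrite big_split /= -scaler_suml hw.2 scale1r opprD addrA.
Qed.

Lemma residual_mulmx (z : 'cV[R]_n) : U^T *m z = 0 ->
  residual U Uk w *m z = z - S *m z.
Proof.
by move=> Uz; rewrite residualE !mulmxBl mul1mx -mulmxA Uz mulmx0 subr0.
Qed.

Hypothesis hU : orthonormal_cols U.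
Hypothesis hUUk : forall k, U^T *m Uk k = 0.

Lemma residual_mulU : residual U Uk w *m U = 0.
Proof.
rewrite residualE !mulmxBl mul1mx -mulmxA hU mulmx1 subrr sub0r mulmx_suml.
rewrite big1 ?oppr0// => k _; rewrite -scalemxAl -mulmxA.
have -> : (Uk k)^T *m U = 0 by rewrite -[LHS]trmxK trmx_mul trmxK hUUk trmx0.
by rewrite mulmx0 scaler0.
Qed.

(* [z] solves [(I - S) z = V x] inside the orthogonal complement of U, on which
   [I - S] is a contraction bounded below by [theta]. *)
Lemma eig_inverse_bounds (q : nat) (V : 'M[R]_(n, q)) (P : 'M[R]_(n, n - r))
    (L : 'M[R]_(n - r)) (x : 'cV[R]_q) : (r <= n)%N ->
  eigendecomposition (residual U Uk w) P L ->
  orthonormal_cols V -> U^T *m V = 0 ->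
  let z := P *m invmx L *m P^T *m V *m x in
  l2norm x <= l2norm z /\ theta Uk w * l2norm z <= l2norm x.
Proof.
move=> rn [hP _ Lu resE] hV UV z.
(* The residual kills U, and L is invertible, so P L P^T U = 0 can be stripped to P^T U = 0. *)
have PU : P^T *m U = 0.
  have : invmx L *m (P^T *m (residual U Uk w *m U)) = 0.
    by rewrite residual_mulU !mulmx0.
  by rewrite resE !mulmxA -(mulmxA _ P^T P) hP mulmx1 mulVmx// mul1mx.
have UP : U^T *m P = 0 by rewrite -[LHS]trmxK trmx_mul trmxK PU trmx0.
have Uz : U^T *m z = 0 by rewrite /z !mulmxA UP !mul0mx.
(* Applying P L P^T to z leaves P P^T V x, and P P^T = I - U U^T fixes V x since U^T V = 0. *)
have zV : z - S *m z = V *m x.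
  rewrite -residual_mulmx// resE /z !mulmxA -(mulmxA _ P^T P) hP mulmx1.
  rewrite mulmxK// -(addrK (U *m U^T) (P *m P^T)) orthonormal_completion//.
  by rewrite mulmxBl mul1mx -(mulmxA U) UV mulmx0 subr0.
have -> : l2norm x = l2norm (z - S *m z).
  by rewrite zV; apply: l2norm_eq; rewrite dot_mulmx mulmxA hV mul1mx.
by split; [exact: l2norm_subS_le|exact: theta_lower].
Qed.

End weighted_projections.

(** * Gram form of M_k and bounds on q_k *)

Lemma Mmx_gram (R : realType) (n m q : nat) (A : 'M[R]_n) (V : 'M[R]_(n, q))
    (P : 'M[R]_(n, m)) (L : 'M[R]_m) : eigendecomposition A P L ->
  let G := P *m invmx L *m P^T *m V in Mmx V P L = G^T *m G.
Proof.
move=> [hP /diag_mxP[d Ld] _ _] G.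
have LT : (invmx L)^T = invmx L by rewrite trmx_inv Ld tr_diag_mx.
(* The two factors of L^-2 go one to each copy of G; the P^T P between them is the identity. *)
rewrite /Mmx /G !trmx_mul !trmxK LT !mulmxA.
by rewrite -(mulmxA _ P^T P) hP mulmx1.
Qed.

(** The trace contributes n - (r + r_k) units and the norm term r + r_k units, each unit between 1
    and theta^-2; the total count n cancels the normalisation. *)
Lemma qcoef_bounds (R : realType) (n r K : nat) (rk : 'I_K -> nat)
    (U : 'M[R]_(n, r)) (Uk : forall k, 'M[R]_(n, rk k))
    (Ubarperp : forall k, 'M[R]_(n, n - (r + rk k)))
    (Uperp : 'rV[R]_K -> 'M[R]_(n, n - r)) (Lam : 'rV[R]_K -> 'M[R]_(n - r))
    (w : 'rV[R]_K) (k : 'I_K) :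
  (r + rk k < n)%N -> orthonormal_cols U ->
  (forall k, orthonormal_cols (Uk k)) -> (forall k, U^T *m Uk k = 0) ->
  orthonormal_compl_basis (Ubar U Uk k) (Ubarperp k) ->
  eigendecomposition (residual U Uk w) (Uperp w) (Lam w) ->
  weight_domain Uk w ->
  1 <= qcoef Ubarperp Uperp Lam k w <= theta Uk w ^- 2.
Proof.
move=> rn hU hUk hUUk [hV /andP[/sub_kermxP VU _]] hE [hw t0].
have {VU}UV : U^T *m Ubarperp k = 0.
  move: VU; rewrite mul_mx_row -row_mx0 => /eq_row_mx[VU _].
  by rewrite -[LHS]trmxK trmx_mul trmxK VU trmx0.
have rn' : (r <= n)%N by apply: leq_trans (ltnW rn); exact: leq_addr.
rewrite /qcoef (Mmx_gram _ hE); set G := _ *m Ubarperp k.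
have GP x := eig_inverse_bounds hUk hw hU hUUk x rn' hE hV UV.
have Glb x : l2norm x <= l2norm (G *m x) by have [] := GP x.
have Gub x : l2norm (G *m x) <= (theta Uk w)^-1 * l2norm x.
  by rewrite ler_pdivlMl//; have [] := GP x.
have c0 : 0 <= (theta Uk w)^-1 by rewrite invr_ge0 ltW.
have /andP[tr1 tr2] := tr_gram_bounds Glb Gub.
have op1 := opnorm_gram_ge1 c0 Glb Gub.
have op2 := opnorm_gram_le c0 Gub.
have n0 : (0 < n)%N by exact: leq_ltn_trans rn.
have nE : n%:R = (n - (r + rk k))%:R + (r + rk k)%:R :> R.
  by rewrite -natrD subnK// ltnW.
have p0 : 0 <= (r + rk k)%:R :> R by [].
rewrite ler_pdivlMl ?ltr0n// ler_pdivrMl ?ltr0n// mulr1 nE -exprVn.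
(* The strict rank bound gives [Ubarperp k] at least one column, as the lower bound on the norm
   requires. *)
rewrite subn_gt0 rn in op1; have {}op1 := op1 isT.
by apply/andP; split; [|rewrite mulrC]; nra.
Qed.

(** * Optimal weights *)

Lemma weighted_sqr_lower (R : realType) (K : nat) (w : 'rV[R]_K)
    (x : 'I_K -> R) : simplex w -> (forall k, 0 < x k) ->
  (\sum_k (x k)^-1)^-1 <= \sum_k w 0 k ^+ 2 * x k.
Proof.
move=> [w0 w1] x0; set T := \sum_k (x k)^-1.
have T0 : 0 <= T by apply: sumr_ge0 => k _; rewrite invr_ge0 ltW.
(* Each summand is the tangent line of w^2 x_k at the optimal weight T^-1 x_k^-1; the error is the
   perfect square added below. If T = 0, both sides are 0 by the convention on inverses. *)
have -> : T^-1 = \sum_k (2 * T^-1 * w 0 k - T^-2 * (x k)^-1).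
  rewrite sumrB -!mulr_sumr w1 -/T; have [->|Tn0] := eqVneq T 0.
    by rewrite invr0 expr0n/=; ring.
  by field.
apply: ler_sum => k _; have xk := x0 k.
have -> : w 0 k ^+ 2 * x k = 2 * T^-1 * w 0 k - T^-2 * (x k)^-1
    + x k * (w 0 k - T^-1 * (x k)^-1) ^+ 2.
  rewrite -exprVn; move: (T^-1) => m; field; exact: lt0r_neq0.
by rewrite lerDl mulr_ge0 ?sqr_ge0 ?ltW.
Qed.

Section wcirc.
Variables (R : realType) (K : nat) (eps : 'I_K -> R).
Hypotheses (hK : (0 < K)%N) (heps : forall k, 0 < eps k).

Lemma xi_gt0 k : 0 < xi eps k.
Proof. by rewrite mulr_gt0 ?exprn_gt0// ltr_pwDl ?sqr_ge0. Qed.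

Let T := \sum_k (xi eps k)^-1.

Let T_gt0 : 0 < T.
Proof.
rewrite /T (bigD1 (Ordinal hK))//= ltr_pwDl ?invr_gt0 ?xi_gt0//.
by apply: sumr_ge0 => k _; rewrite invr_ge0 ltW ?xi_gt0.
Qed.

Lemma wcirc_simplex : simplex (wcirc eps).
Proof.
split=> [k|]; first by rewrite mxE ltW// divr_gt0 ?invr_gt0 ?xi_gt0.
by under eq_bigr do rewrite mxE; rewrite -mulr_suml divff// gt_eqF.
Qed.

(** Equality case of [weighted_sqr_lower] with [x := xi eps]. *)
Lemma wcirc_weighted_sqr :
  \sum_k wcirc eps 0 k ^+ 2 * xi eps k = T^-1.
Proof.
transitivity (\sum_k (T^-2 * (xi eps k)^-1)); last first.
  by rewrite -mulr_sumr -/T expr2 invfM -mulrA mulVf ?mulr1 ?gt_eqF.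
apply: eq_bigr => k _; rewrite mxE -/T.
by field; rewrite !gt_eqF ?xi_gt0.
Qed.

End wcirc.

(** * Comparison of J at the explicit weights with its infimum *)

Theorem proposition3 (R : realType) (n r K : nat) (rk : 'I_K -> nat)
    (U : 'M[R]_(n, r)) (Uk : forall k : 'I_K, 'M[R]_(n, rk k))
    (Ubarperp : forall k : 'I_K, 'M[R]_(n, n - (r + rk k)))
    (Uperp : 'rV[R]_K -> 'M[R]_(n, n - r)) (Lam : 'rV[R]_K -> 'M[R]_(n - r))
    (eps : 'I_K -> R)
    (hK : (0 < K)%N)
    (hrank : forall k : 'I_K, (r + rk k < n)%N)
    (hU : orthonormal_cols U)
    (hUk : forall k : 'I_K, orthonormal_cols (Uk k))
    (hUUk : forall k : 'I_K, U^T *m Uk k = 0)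
    (hUbarperp : forall k : 'I_K,
       orthonormal_compl_basis (Ubar U Uk k) (Ubarperp k))
    (heig : forall w : 'rV[R]_K, weight_domain Uk w ->
       eigendecomposition (residual U Uk w) (Uperp w) (Lam w))
    (heps : forall k : 'I_K, 0 < eps k) :
  let J := J Uk Ubarperp Uperp Lam eps in
  let Jstar := Jstar Uk Ubarperp Uperp Lam eps in
  let w0 := wcirc eps in
  [/\ simplex w0,
      0 < theta Uk w0 ->
        (J w0 <= (theta Uk w0 ^- 2)%:E * Jstar)%E
    & forall c0 : R, 0 < c0 < 1 -> c0 <= theta Uk w0 ->
        (Jstar <= J w0)%E /\ (J w0 <= (c0 ^- 2)%:E * Jstar)%E].
Proof.
move=> JJ JJstar w0; have hw0 : simplex w0 by exact: wcirc_simplex.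
(* The minimum of sum_k w_k^2 xi_k over the simplex, used as a benchmark between [JJstar] and
   [JJ w0]. *)
pose m : R := (\sum_k (xi eps k)^-1)^-1.
have xi0 k : 0 < xi eps k by exact: xi_gt0.
have m0 : 0 <= m by rewrite invr_ge0 sumr_ge0// => k _; rewrite invr_ge0 ltW.
have qb w k : weight_domain Uk w ->
    1 <= qcoef Ubarperp Uperp Lam k w <= theta Uk w ^- 2.
  by move=> hw; apply: (@qcoef_bounds _ _ _ _ _ U) => //; exact: heig.
have mJ : (m%:E <= JJstar)%E.
  apply/ereal_infP => _ [w hw <-]; rewrite /J.
  case: ifPn => [|_]; last exact: leey.
  rewrite inE => dw; rewrite lee_fin.
  apply: (le_trans (weighted_sqr_lower hw xi0)); apply: ler_sum => k _.
  have /andP[q1 _] := qb w k dw.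
  (* Read off from the two bounds that sandwich q_k; it handles the eps^4 terms. *)
  have t1 : 1 <= theta Uk w ^- 2.
    by rewrite (le_trans q1)//; have /andP[] := qb w k dw.
  rewrite ler_wpM2l ?sqr_ge0// /xi mulrDr mulr1 -exprD.
  by apply: lerD; rewrite ler_peMl// exprn_ge0// ltW.
have Jw0 : 0 < theta Uk w0 -> (JJ w0 <= (theta Uk w0 ^- 2 * m)%:E)%E.
  move=> t0; have dw : weight_domain Uk w0 by [].
  rewrite /JJ /J mem_set// lee_fin /m -wcirc_weighted_sqr// mulr_sumr.
  (* The eps^4 terms agree exactly on both sides, so only the upper bound on q_k is needed. *)
  apply: ler_sum => k _; rewrite [leRHS]mulrCA ler_wpM2l ?sqr_ge0//.
  rewrite /xi mulrDr mulr1 -exprD mulrDr lerD2r ler_wpM2r ?sqr_ge0//.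
  by have /andP[] := qb w0 k dw.
(* Taking c to be theta itself gives the first inequality; taking it to be [c0] gives the second. *)
have main c : 0 < c -> c <= theta Uk w0 -> (JJ w0 <= (c ^- 2)%:E * JJstar)%E.
  move=> c0 ct; have t0 := lt_le_trans c0 ct.
  have ic : 0 <= c ^- 2 by rewrite invr_ge0 sqr_ge0.
  apply: (le_trans (Jw0 t0)).
  apply: (@le_trans _ _ ((c ^- 2)%:E * m%:E)%E); last first.
    by rewrite lee_wpmul2l// lee_fin.
  rewrite -EFinM lee_fin ler_wpM2r// lef_pV2 ?posrE ?exprn_gt0//.
  by rewrite ler_sqr// nnegrE ltW.
split=> // [t0|c0 /andP[c00 _] ct]; first exact: main.
by split; [apply: ereal_inf_lbound; exists w0|exact: main].
Qed.
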